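(* Let $\lambda,\mu>0$, let $T:\mathcal H\to\mathcal H$ be a $\lambda$-relaxed cutter and $U:\mathcal H\to\mathcal H$ be a $\mu$-relaxed cutter with $\operatorname{Fix}T\cap\operatorname{Fix}U\ne\emptyset$. When $\lambda\mu\ne4$ put $\nu^*:=\frac{4(\lambda+\mu-\lambda\mu)}{4-\lambda\mu}$. Then: (i) For all $x\in\mathcal H$, all $z\in\operatorname{Fix}T\cap\operatorname{Fix}U$ and all $\nu\in\mathbb R\setminus\{0\}$, writing $a:=T(x)-x$ and $b:=UT(x)-T(x)$, $$\langle z-x,UT(x)-x\rangle-\tfrac1\nu\|UT(x)-x\|^2\ge\left(\tfrac1\lambda-\tfrac1\nu\right)\|a\|^2+\left(\tfrac1\mu-\tfrac1\nu\right)\|b\|^2+\left(1-\tfrac2\nu\right)\langle a,b\rangle.$$ (ii) If $\lambda\mu<4$, then $UT$ is a $\nu^*$-relaxed cutter. Moreover, if $\dim\mathcal H\ge2$, then the constant $\nu^*$ is optimal, i.e. for arbitrary $\rho\in(0,\nu^* )$ there are a $\lambda$-relaxed cutter $T:\mathcal H\to\mathcal H$ and a $\mu$-relaxed cutter $U:\mathcal H\to\mathcal H$ with $\operatorname{Fix}T\cap\operatorname{Fix}U\neq\emptyset$ such that $UT$ is not a $\rho$-relaxed cutter. (iii) If $\lambda\mu<\lambda+\mu$, then $\operatorname{Fix}UT=\operatorname{Fix}T\cap\operatorname{Fix}U$. (iv) Suppose that $\lambda\mu>4$. If $\lambda\mu\le\lambda+\mu$ and $\dim\mathcal H\ge2$,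 or if $\lambda\mu>\lambda+\mu$, then there are a $\lambda$-relaxed cutter $T:\mathcal H\to\mathcal H$ and a $\mu$-relaxed cutter $U:\mathcal H\to\mathcal H$ with $\operatorname{Fix}T\cap\operatorname{Fix}U\neq\emptyset$ such that $UT$ is not a relaxed cutter. (v) If $\lambda\mu\ge\lambda+\mu$, then there are a $\lambda$-relaxed cutter $T:\mathcal H\to\mathcal H$ and a $\mu$-relaxed cutter $U:\mathcal H\to\mathcal H$ with $\operatorname{Fix}T\cap\operatorname{Fix}U\neq\emptyset$ such that $\operatorname{Fix}UT\ne\operatorname{Fix}T\cap\operatorname{Fix}U$. (vi) Suppose that $T$ and $U$ satisfy the demi closedness principle. If $4\neq\lambda\mu<\lambda+\mu$, then the operators $UT$ and $(UT)_{1/\nu^*}$ also satisfy the demi closedness principle.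
   Context: $\mathcal H$ is a real Hilbert space with $\mathcal H\neq\{0\}$; $UT$ denotes the composition $U\circ T$; $\operatorname{Fix}T:=\{z\in\mathcal H:T(z)=z\}$. For $\lambda>0$, an operator $T:\mathcal H\to\mathcal H$ with $\operatorname{Fix}T\neq\emptyset$ is a $\lambda$-relaxed cutter if $\lambda\langle z-x,T(x)-x\rangle\ge\|T(x)-x\|^2$ for all $x\in\mathcal H$, $z\in\operatorname{Fix}T$; it is a relaxed cutter if it is a $\lambda$-relaxed cutter for some $\lambda>0$. For a real number $\rho\neq0$ and an operator $S$, $S_\rho:=\operatorname{Id}+\rho(S-\operatorname{Id})$. An operator $T$ satisfies the demi closedness principle if for any bounded sequence $\{x^k\}$ with $\|T(x^k)-x^k\|\to0$, every weak cluster point of $\{x^k\}$ belongs to $\operatorname{Fix}T$. *)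

(* Defs.v *)
From HB Require Import structures.
From mathcomp Require Import all_boot all_order all_algebra sesquilinear.
From mathcomp Require Import all_classical all_reals all_analysis.

Set Implicit Arguments.
Unset Strict Implicit.
Unset Printing Implicit Defensive.

Import Order.TTheory GRing.Theory Num.Theory.
Import numFieldNormedType.Exports.

Local Open Scope classical_set_scope.
Local Open Scope ring_scope.

(* A real Hilbert space is a complete normed module H over a realType R with a
   positive definite symmetric bilinear form ip inducing its norm. *)
Definition induces_norm (R : realType) (H : completeNormedModType R)
    (ip : {dot H for idfun}) : Prop :=
  forall x : H, `|x| ^+ 2 = ip x x.

Definition dim_ge (R : realType) (H : completeNormedModType R) (n : nat) : Prop :=
  exists e : 'I_n -> H, forall a : 'I_n -> R,
    \sum_(i < n) a i *: e i = 0 -> forall i, a i = 0.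

Definition Fix (H : Type) (T : H -> H) : set H := [set z | T z = z].

Definition lrelaxed_cutter (R : realType) (H : completeNormedModType R)
    (ip : {dot H for idfun}) (lambda : R) (T : H -> H) : Prop :=
  [/\ 0 < lambda, Fix T !=set0 &
    forall x z : H, Fix T z ->
      lambda * ip (z - x) (T x - x) >= `|T x - x| ^+ 2].

Definition relaxed_cutter (R : realType) (H : completeNormedModType R)
    (ip : {dot H for idfun}) (T : H -> H) : Prop :=
  exists lambda : R, lrelaxed_cutter ip lambda T.

Definition relaxation (R : realType) (H : completeNormedModType R)
    (rho : R) (S : H -> H) : H -> H :=
  fun x => x + rho *: (S x - x).

(* The weak topology: the coarsest one making every x |-> ip x y continuous
   (by Riesz representation these are all the continuous linear forms). *)
Definition weak (R : realType) (H : completeNormedModType R)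
    (ip : {dot H for idfun}) : topologicalType :=
  initial_topology (fun x : H => (fun y : H => ip x y) : {ptws H -> R}).

Definition weak_cluster_point (R : realType) (H : completeNormedModType R)
    (ip : {dot H for idfun}) (x : nat -> H) (p : H) : Prop :=
  cluster ((x : nat -> weak ip) @ \oo) (p : weak ip).

Definition demiclosedness_principle (R : realType)
    (H : completeNormedModType R) (ip : {dot H for idfun}) (T : H -> H) : Prop :=
  forall x : nat -> H, bounded_fun x ->
    (fun k => `|T (x k) - x k|) @ \oo --> (0 : R) ->
    forall p : H, weak_cluster_point ip x p -> Fix T p.

Definition nu_star (R : realType) (lambda mu : R) : R :=
  4 * (lambda + mu - lambda * mu) / (4 - lambda * mu).

(* Main.v *)
Require Import Defs.
From HB Require Import structures.
From mathcomp Require Import all_boot all_order all_algebra sesquilinear.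
From mathcomp Require Import all_classical all_reals all_analysis.
From mathcomp Require Import ring lra.

Set Implicit Arguments.
Unset Strict Implicit.
Unset Printing Implicit Defensive.

Import Order.TTheory GRing.Theory Num.Theory.
Import numFieldNormedType.Exports.

Local Open Scope classical_set_scope.
Local Open Scope ring_scope.

(** Write a = T x - x and b = U (T x) - T x.  For a common fixed point z, the
    cutter inequality of T at x and that of U at T x add up to
      Q(a, b) <= <z - x, a + b>,
      Q(a, b) = |a|^2 / lambda + |b|^2 / mu + <a, b>
    ([step_form_le]), and everything that the composition satisfies is a
    property of the quadratic form Q.  Put D = lambda + mu - lambda mu.

    - Subtracting |a + b|^2 / nu from Q gives the general inequality.
      The value nu_star is the one for which the resulting binary form is
      degenerate; if D > 0 it is then a nonnegative multiple of a square
      ([step_form_nu_star]), so the cutter inequality with constant nu_star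
      holds.  If lambda mu < 4, both D and nu_star are positive.
    - On the antidiagonal, Q(a, - a) = (D / (lambda mu)) |a|^2.  If D > 0, a fixed
      point x of U T, where a + b = 0 and hence Q(a, b) <= 0, must have a = 0
      ([Fix_comp]).  The quantitative form of the same remark says that
      |a| tends to 0 when |a + b| does, uniformly over bounded sets
      ([first_step_sqr_le]); then |b| tends to 0 too, and demi-closedness of T
      and of U can be used one after the other, because x_k and T x_k have the
      same weak cluster points ([weak_cluster_shift]).
    - Conversely, for any two linearly independent steps a and b, some point x
      makes both cutter inequalities equalities for z = 0, since this only
      prescribes <x, a> and <x, b>.  Operators need not be continuous, so a cutter
      can be given the step a at the single point x and be (1 - lambda) Id elsewhere.
      Thus U T is not a rho-relaxed cutter as soon as rho Q(a, b) < |a + b|^2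
      ([sharp_pair]).  Perturbing collinear steps that make the square above
      vanish shows that nu_star is optimal; perturbing collinear steps with
      Q < 0, which exist when lambda mu > 4, shows that U T need not be a
      relaxed cutter.
    - If D <= 0, homotheties suffice: (1 - lambda) Id followed by (1 - mu) Id is
      (1 - D) Id, which pushes nonzero points away from 0 when D < 0, and two suitable
      homotheties have the identity as composition. *)

(** * Inner products *)

Section InnerProduct.
Context {R : realType} {H : completeNormedModType R}.
Context (ip : {dot H for idfun}) (ip_norm : induces_norm ip).
Implicit Types x y z a b : H.

Lemma ipC x y : ip x y = ip y x.
Proof. by rewrite [LHS]hermC expr0 mul1r. Qed.

Lemma ip0r x : ip x 0 = 0.
Proof. exact: raddf0. Qed.

Lemma ipDr x y z : ip x (y + z) = ip x y + ip x z.
Proof. exact: raddfD. Qed.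

Lemma ipNr x y : ip x (- y) = - ip x y.
Proof. exact: raddfN. Qed.

Lemma ipZr k x y : ip x (k *: y) = k * ip x y.
Proof. exact: linearZr_LR. Qed.

Lemma ipDl x y z : ip (x + y) z = ip x z + ip y z.
Proof. by rewrite ipC ipDr !(ipC z). Qed.

Lemma ipNl x y : ip (- x) y = - ip x y.
Proof. by rewrite ipC ipNr ipC. Qed.

Lemma ipZl k x y : ip (k *: x) y = k * ip x y.
Proof. by rewrite ipC ipZr ipC. Qed.

Definition ipE := (ipDl, ipDr, ipNl, ipNr, ipZl, ipZr).

Lemma ip_gt0 x : x != 0 -> 0 < ip x x.
Proof. by move=> x0; rewrite -ip_norm exprn_gt0 // normr_gt0. Qed.

(** Cauchy-Schwarz, from |<y, y> x - <x, y> y|^2 >= 0. *)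
Lemma ip_le_norm x y : `|ip x y| <= `|x| * `|y|.
Proof.
have [->|y0] := eqVneq y 0.
  by rewrite ip0r normr0 mulr_ge0.
have yy := ip_gt0 y0.
rewrite -ler_sqr ?nnegrE ?mulr_ge0 // exprMn !ip_norm real_normK ?num_real //.
have : 0 <= `|ip y y *: x - ip x y *: y| ^+ 2 by rewrite exprn_ge0.
rewrite ip_norm !ipE (ipC y x) => h.
rewrite -(ler_pM2l yy); nra.
Qed.

End InnerProduct.

(** * Weak cluster points *)

Section Weak.
Context {R : realType} {H : completeNormedModType R}.
Context (ip : {dot H for idfun}) (ip_norm : induces_norm ip).

(** The weak topology is pulled back from a space of functions with the
    topology of pointwise convergence. *)
Lemma weak_cvgP (I : Type) (F : set_system I) (FF : Filter F)
    (x : I -> H) (p : H) :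
  (x : I -> weak ip) @ F --> (p : weak ip) <->
  forall y, (fun i => ip (x i) y) @ F --> ip p y.
Proof.
pose f : H -> {ptws H -> R} := fun u v => ip u v.
suff fE : (x : I -> weak ip) @ F --> (p : weak ip) <-> (f \o x) @ F --> f p.
  by rewrite fE; exact: (@pointwise_cvgP H R ((f \o x) @ F) (f p)).
split=> [xp|fxp A].
  exact: (cvg_comp _ _ xp (@initial_continuous _ _ (f : H -> {ptws H -> R}) p)).
case=> _ [[B Bo <-] Bp BA].
rewrite nbhs_simpl; apply: filterS (fun i => BA (x i)) _.
by apply: fxp; exact: open_nbhs_nbhs.
Qed.

(** The weak neighbourhoods of p, pulled back along x, and the tails of nat
    generate a proper filter, along which x converges weakly to p.  Since y - x
    tends to 0 strongly, y converges weakly to p along the same filter. *)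
Lemma weak_cluster_shift (x y : nat -> H) (p : H) :
  weak_cluster_point ip x p -> (fun k => `|y k - x k|) @ \oo --> (0 : R) ->
  weak_cluster_point ip y p.
Proof.
move=> xp yx.
pose base := [set AB : set nat * set (weak ip) | \oo AB.1 /\ nbhs (p : weak ip) AB.2].
pose G : set_system nat := filter_from base (fun AB => AB.1 `&` x @^-1` AB.2).
have GP : ProperFilter G.
  apply: filter_from_proper.
    apply: filter_from_filter.
      by exists (setT, setT); split; exact: filterT.
    move=> [A B] [A' B'] [/= oA nB] [/= oA' nB'].
    exists (A `&` A', B `&` B'); first by split; exact: filterI.
    by move=> i /= [[? ?] [? ?]].
  move=> [A B] [/= oA nB].
  have [|_ [[i Ai <-] Bi]] := xp (x @` A) B _ nB; last by exists i.
  by apply: filterS oA => i Ai; exists i.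
have oG : G --> \oo.
  by move=> A oA; exists (A, setT) => [|i []//]; split => //; exact: filterT.
have xG : (x : nat -> weak ip) @ G --> (p : weak ip).
  by move=> B nB; exists (setT, B) => [|i []//]; split => //; exact: filterT.
have yG : (y : nat -> weak ip) @ G --> (p : weak ip).
  apply/(proj2 (weak_cvgP GP y p)) => v.
  have -> : (fun i => ip (y i) v) = (fun i => ip (x i) v + ip (y i - x i) v).
    by apply: funext => i; rewrite -ipDl addrC subrK.
  rewrite -[X in _ --> X]addr0; apply: cvgD; first exact: (proj1 (weak_cvgP GP x p) xG v).
  suff : (fun i => ip (y i - x i) v) @ \oo --> (0 : R).
    by apply: cvg_trans; apply: cvg_fmap2.
  apply/norm_cvg0P; apply: (@squeeze_cvgr _ _ _ _ (fun=> 0)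
    (fun k => `|y k - x k| * `|v|)); last 2 first.
  - exact: cvg_cst.
  - by rewrite -[X in _ --> X](mul0r `|v|); apply: cvgM yx (cvg_cst _).
  by near=> k; rewrite normr_ge0 /= ip_le_norm.
move=> A B yA nB.
have [k [yAk Bk]] := filter_ex (filterI (oG _ yA) (yG B nB)).
by exists (y k).
Unshelve. all: by end_near.
Qed.
End Weak.

Lemma bounded_seqP (R : realType) (V : normedModType R) (x : nat -> V) :
  bounded_fun x <-> exists M, forall k, `|x k| <= M.
Proof.
split=> [/pinfty_ex_gt0[M _ xM]|[M xM]]; first by exists M => k; exact: xM.
by exists M; split; rewrite ?num_real // => N MN k _; apply: le_trans (xM k) (ltW MN).
Qed.


(** * The step form of a composition *)

Section Composition.
Context {R : realType} {H : completeNormedModType R}.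
Context (ip : {dot H for idfun}) (ip_norm : induces_norm ip).
Context (lambda mu : R) (lambda_gt0 : 0 < lambda) (mu_gt0 : 0 < mu).
Implicit Types (x z a b v w : H) (T U : H -> H).

(** The form Q: the lower bound for <z - x, U (T x) - x> that the two
    cutter inequalities give in terms of the steps a and b. *)
Definition step_form a b : R :=
  `|a| ^+ 2 / lambda + `|b| ^+ 2 / mu + ip a b.

(** <z - x, a + b> = <z - x, a> + <z - T x, b> + <a, b>: the first two terms are
    the ones that the cutter inequalities of T at x and of U at T x bound. *)
Lemma step_form_le T U : lrelaxed_cutter ip lambda T -> lrelaxed_cutter ip mu U ->
  forall x z, (Fix T `&` Fix U) z ->
  step_form (T x - x) (U (T x) - T x) <= ip (z - x) (U (T x) - x).
Proof.
move=> [_ _ +] [_ _ +] x z => /(_ x z) hT /(_ (T x) z) hU [/hT{}hT /hU{}hU].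
have -> : ip (z - x) (U (T x) - x) = ip (z - x) (T x - x)
    + ip (z - T x) (U (T x) - T x) + ip (T x - x) (U (T x) - T x).
  by rewrite !ipE; ring.
by rewrite lerD2r lerD // ler_pdivrMr // mulrC.
Qed.

Lemma step_formE nu a b :
  step_form a b - nu^-1 * `|a + b| ^+ 2 =
  (lambda^-1 - nu^-1) * `|a| ^+ 2 + (mu^-1 - nu^-1) * `|b| ^+ 2
  + (1 - 2 / nu) * ip a b.
Proof. by rewrite /step_form !ip_norm !ipE (ipC ip b a); ring. Qed.

(** Let s = lambda mu.  As (lambda + mu)^2 >= 4 s > s^2 for 0 < s < 4, the sum
    exceeds the product. *)
Lemma prod_lt_add : lambda * mu < 4 -> lambda * mu < lambda + mu.
Proof.
move=> h; rewrite ltNge; apply/negP => h2.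
have s0 : 0 < lambda * mu by rewrite mulr_gt0.
have : (lambda + mu) ^+ 2 <= (lambda * mu) ^+ 2.
  by rewrite ler_sqr // nnegrE ltW // addr_gt0.
have : 0 <= (lambda - mu) ^+ 2 by exact: sqr_ge0.
nra.
Qed.

(** nu_star is the root nu of
      (1/lambda - 1/nu) (1/mu - 1/nu) = (1/2 - 1/nu)^2,
    so subtracting |a + b|^2 / nu_star leaves a multiple of a square. *)
Lemma step_form_nu_star a b : lambda * mu != 4 -> lambda * mu < lambda + mu ->
  step_form a b = (nu_star lambda mu)^-1 * `|a + b| ^+ 2
    + (4 * (lambda + mu - lambda * mu) * (lambda * mu))^-1
      * `|(mu * (lambda - 2)) *: a - (lambda * (mu - 2)) *: b| ^+ 2.
Proof.
move=> lm4 lmD; rewrite /step_form /nu_star !ip_norm !ipE (ipC ip b a).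
field.
by rewrite ?subr_eq0 1?[4 == _]eq_sym lm4 /= !gt_eqF //.
Qed.

Local Notation kappa := (lambda^-1 + mu^-1 - 1).

Lemma kappa_gt0 : (0 < kappa) = (lambda * mu < lambda + mu).
Proof.
have -> : kappa = (lambda + mu - lambda * mu) / (lambda * mu).
  by field; rewrite !gt_eqF.
by rewrite pmulr_lgt0 ?subr_gt0 // invr_gt0 mulr_gt0.
Qed.

(** This is the reason why the sign of lambda + mu - lambda mu decides about
    the fixed points: a fixed point of U T has steps a and - a. *)
Lemma step_form_opp a : step_form a (- a) = kappa * `|a| ^+ 2.
Proof. by rewrite /step_form normrN !ipE ip_norm; ring. Qed.

(** At a fixed point of U T the two steps are opposite, and the form is at most 0
    there; as it is positive definite on opposite steps, both vanish. *)
Lemma Fix_comp T U :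
  lrelaxed_cutter ip lambda T -> lrelaxed_cutter ip mu U ->
  Fix T `&` Fix U !=set0 -> lambda * mu < lambda + mu ->
  Fix (U \o T) = Fix T `&` Fix U.
Proof.
move=> hT hU [z zTU] lmD; apply/seteqP; split=> x; last first.
  by rewrite /Fix /= => -[Tx Ux]; rewrite Tx.
rewrite /Fix /= => UTx.
have := step_form_le hT hU x zTU.
rewrite UTx -(opprB (T x) x) step_form_opp subrr ip0r.
rewrite pmulr_rle0 ?kappa_gt0 // => hle.
have Tx : T x = x.
  by apply/eqP; rewrite -subr_eq0 -normr_eq0 -sqrf_eq0 eq_le hle sqr_ge0.
by split; rewrite /= ?Tx // -{1}Tx.
Qed.

Lemma lrelaxed_cutter_comp T U :
  lrelaxed_cutter ip lambda T -> lrelaxed_cutter ip mu U ->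
  Fix T `&` Fix U !=set0 -> lambda * mu < 4 ->
  lrelaxed_cutter ip (nu_star lambda mu) (U \o T).
Proof.
move=> hT hU TU lm4; have lmD := prod_lt_add lm4.
have nu0 : 0 < nu_star lambda mu.
  by rewrite /nu_star !(divr_gt0, mulr_gt0) ?subr_gt0.
have FE := Fix_comp hT hU TU lmD.
split; rewrite ?FE // => x z zTU.
have := step_form_le hT hU x zTU.
rewrite step_form_nu_star ?lt_eqF // (addrC (T x - x)) subrKA => hle.
rewrite /= -ler_pdivrMl //; apply: le_trans hle.
by rewrite lerDl mulr_ge0 ?sqr_ge0 // invr_ge0 !mulr_ge0 ?subr_ge0 ?ltW.
Qed.

(** In the variables a and c = a + b, the form is
      kappa |a|^2 + (1 - 2 / mu) <a, c> + |c|^2 / mu;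
    Young's inequality absorbs the cross term into half of the first one. *)
Lemma first_step_sqr_le a b N : lambda * mu < lambda + mu ->
  step_form a b <= N * `|a + b| ->
  `|a| ^+ 2 <= kappa^-1 *
    (2 * N * `|a + b| + (1 - 2 / mu) ^+ 2 / kappa * `|a + b| ^+ 2).
Proof.
rewrite -kappa_gt0 => k0; set c := a + b => hle.
have QE : step_form a b =
    kappa * `|a| ^+ 2 + (1 - 2 / mu) * ip a c + `|c| ^+ 2 / mu.
  by rewrite /step_form !ip_norm /c !ipE (ipC ip b a); ring.
rewrite {}QE in hle; clearbody c.
have young : 0 <= (kappa * `|a| ^+ 2 + (1 - 2 / mu) ^+ 2 / kappa * `|c| ^+ 2) / 2
    + (1 - 2 / mu) * ip a c.
  have <- : `|kappa *: a + (1 - 2 / mu) *: c| ^+ 2 / (2 * kappa) =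
      (kappa * `|a| ^+ 2 + (1 - 2 / mu) ^+ 2 / kappa * `|c| ^+ 2) / 2
      + (1 - 2 / mu) * ip a c.
    rewrite !ip_norm !ipE (ipC ip c a); field.
    by rewrite !gt_eqF //; move: k0; rewrite kappa_gt0; lra.
  by rewrite divr_ge0 ?sqr_ge0 // mulr_ge0 ?ltW.
have cc : 0 <= `|c| ^+ 2 / mu by rewrite divr_ge0 ?sqr_ge0 ?ltW.
rewrite ler_pdivlMl //; lra.
Qed.

(** Along a bounded sequence |z - x_k| <= N, so Q <= N |a + b|, and the bound
    on |a|^2 that this gives tends to 0 with |a + b|. *)
Lemma first_step_cvg0 T U (x : nat -> H) :
  lrelaxed_cutter ip lambda T -> lrelaxed_cutter ip mu U ->
  Fix T `&` Fix U !=set0 -> lambda * mu < lambda + mu ->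
  bounded_fun x -> (fun k => `|U (T (x k)) - x k|) @ \oo --> (0 : R) ->
  (fun k => `|T (x k) - x k|) @ \oo --> (0 : R).
Proof.
move=> hT hU [z zTU] lmD /bounded_seqP[M xM] cvg0.
pose N := `|z| + M.
set C := (fun k => `|U (T (x k)) - x k|) in cvg0.
pose g k := kappa^-1 *
  (2 * N * C k + (1 - 2 / mu) ^+ 2 / kappa * C k ^+ 2).
have g0 : g @ \oo --> (0 : R).
  have -> : 0 = kappa^-1 * (2 * N * 0 + (1 - 2 / mu) ^+ 2 / kappa * 0 ^+ 2) :> R.
    by rewrite expr0n /= !mulr0 addr0 mulr0.
  apply: cvgMl_tmp; apply: cvgD; apply: cvgMl_tmp => //.
  exact: cvgM.
apply: (@squeeze_cvgr _ _ _ _ (fun=> 0) (fun k => Num.sqrt (g k))); last 2 first.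
- exact: cvg_cst.
- by rewrite -[X in _ --> X]sqrtr0; exact: (cvg_comp _ _ g0 (@sqrt_continuous R 0)).
near=> k; rewrite normr_ge0 /= -(ger0_norm (normr_ge0 (T _ - _))) -sqrtr_sqr.
apply: ler_wsqrtr.
have cE : T (x k) - x k + (U (T (x k)) - T (x k)) = U (T (x k)) - x k.
  by rewrite (addrC (T (x k) - x k)) subrKA.
have := @first_step_sqr_le (T (x k) - x k) (U (T (x k)) - T (x k)) N lmD.
rewrite cE; apply.
apply: le_trans (step_form_le hT hU (x k) zTU) _.
apply: le_trans (ler_norm _) _; apply: le_trans (ip_le_norm ip_norm _ _) _.
by rewrite ler_wpM2r // (le_trans (ler_normB _ _)) // lerD2l.
Unshelve. all: by end_near.
Qed.

Lemma demiclosed_comp T U :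
  lrelaxed_cutter ip lambda T -> lrelaxed_cutter ip mu U ->
  Fix T `&` Fix U !=set0 -> lambda * mu < lambda + mu ->
  demiclosedness_principle ip T -> demiclosedness_principle ip U ->
  demiclosedness_principle ip (U \o T).
Proof.
move=> hT hU TU lmD dT dU x xb cvg0 p xp.
have a0 := first_step_cvg0 hT hU TU lmD xb cvg0.
rewrite (Fix_comp hT hU TU lmD); split; first exact: dT xb a0 p xp.
apply: (dU (T \o x)); last exact: (weak_cluster_shift ip_norm xp a0); last first.
  apply: (@squeeze_cvgr _ _ _ _ (fun=> 0)
    (fun k => `|U (T (x k)) - x k| + `|T (x k) - x k|)); last 2 first.
  - exact: cvg_cst.
  - by rewrite -[X in _ --> X]addr0; exact: cvgD cvg0 a0.
  near=> k; rewrite normr_ge0 /= -(subrKA (x k)) (le_trans (ler_normD _ _)) //.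
  by rewrite (distrC (x k)).
have [M xM] := proj1 (bounded_seqP x) xb.
have /cvg_seq_bounded/bounded_seqP[N aN] := cvgP _ a0.
apply/bounded_seqP; exists (N + M) => k /=; rewrite -(subrK (x k) (T (x k))).
rewrite (le_trans (ler_normD _ _)) // lerD //.
by rewrite -(ger0_norm (normr_ge0 (_ - _))).
Unshelve. all: by end_near.
Qed.

End Composition.

(** A relaxation has the same fixed points, and its displacement is the one
    of the operator multiplied by rho. *)
Lemma demiclosed_relaxation (R : realType) (H : completeNormedModType R)
    (ip : {dot H for idfun}) (rho : R) (S : H -> H) :
  rho != 0 -> demiclosedness_principle ip S ->
  demiclosedness_principle ip (relaxation rho S).
Proof.
move=> rho0 dS x xb cvg0 p xp.
have /(dS x xb)/(_ p xp) Sp : (fun k => `|S (x k) - x k|) @ \oo --> (0 : R).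
  have -> : (fun k => `|S (x k) - x k|) =
      (fun k => `|rho|^-1 * `|relaxation rho S (x k) - x k|).
    apply: funext => k; rewrite /relaxation addrAC subrr add0r normrZ mulKf //.
    by rewrite normr_eq0.
  by rewrite -(mulr0 `|rho|^-1); apply: cvgMl_tmp.
by rewrite /Fix /= /relaxation Sp subrr scaler0 addr0.
Qed.

(** * Cutters with prescribed steps *)

Section Counterexamples.
Context {R : realType} {H : completeNormedModType R}.
Context (ip : {dot H for idfun}) (ip_norm : induces_norm ip).
Implicit Types (x z a b v w : H) (T U : H -> H).

Lemma Fix_scale (t : R) : t != 0 ->
  Fix (fun y : H => (1 - t) *: y) = [set 0].
Proof.
move=> t0; apply/seteqP; split=> z; rewrite /Fix /=; last by move->; rewrite scaler0.
move/eqP; rewrite scalerBl scale1r -subr_eq0 addrAC subrr add0r oppr_eq0.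
by rewrite scaler_eq0 (negPf t0) /= => /eqP.
Qed.

Lemma lrelaxed_cutter_scale (lambda t : R) : 0 < t -> t <= lambda ->
  lrelaxed_cutter ip lambda (fun y => (1 - t) *: y).
Proof.
move=> t0 tl; have l0 := lt_le_trans t0 tl.
rewrite /lrelaxed_cutter Fix_scale ?gt_eqF //; split=> //; first by exists 0.
move=> x _ ->; rewrite scalerBl scale1r addrAC subrr !add0r.
rewrite normrN normrZ gtr0_norm // exprMn ip_norm !ipE !opprK mulrA.
by rewrite -ip_norm ler_wpM2r ?sqr_ge0 // expr2 ler_pM2r.
Qed.

(** A cutter may be discontinuous, so its step at the single point x can be
    chosen freely, subject to the cutter inequality at x. *)
Definition detour (lambda : R) x a y : H :=
  if y == x then x + a else (1 - lambda) *: y.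

Lemma Fix_detour (lambda : R) x a : 0 < lambda -> a != 0 -> x != 0 ->
  Fix (detour lambda x a) = [set 0].
Proof.
move=> l0 a0 x0; rewrite -(@Fix_scale lambda) ?gt_eqF //.
apply/seteqP; split=> z; rewrite /Fix /detour /=; case: eqVneq => // ->.
  by move/eqP; rewrite -subr_eq0 addrAC subrr add0r (negPf a0).
move/eqP; rewrite scalerBl scale1r -subr_eq0 addrAC subrr add0r oppr_eq0.
by rewrite scaler_eq0 (negPf x0) gt_eqF.
Qed.

(** The equation says that the cutter inequality at x for the fixed point 0 is
    an equality; it also forces x != 0, so that 0 remains a fixed point. *)
Lemma lrelaxed_cutter_detour (lambda : R) x a : 0 < lambda -> a != 0 ->
  ip x a = - (`|a| ^+ 2 / lambda) ->
  lrelaxed_cutter ip lambda (detour lambda x a) /\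
  Fix (detour lambda x a) = [set 0].
Proof.
move=> l0 a0 xa.
have x0 : x != 0.
  apply: contraPneq xa => ->; rewrite ipC ip0r => /esym/eqP.
  by rewrite oppr_eq0 mulf_eq0 sqrf_eq0 normr_eq0 (negPf a0) invr_eq0 gt_eqF.
have FE : Fix (detour lambda x a) = [set 0] by exact: Fix_detour.
split=> //; split=> //; first by rewrite FE; exists 0.
move=> y z; rewrite FE /detour /= => ->; case: eqVneq => [->|_].
  rewrite addrAC subrr !add0r ipNl xa opprK mulrC divfK ?gt_eqF //.
have [_ _] := lrelaxed_cutter_scale l0 (lexx lambda).
by apply; rewrite Fix_scale ?gt_eqF.
Qed.

Lemma ip_interpolation v w (a1 a2 b1 b2 p q : R) :
  ip v v = 1 -> ip w w = 1 -> ip v w = 0 -> a1 * b2 != a2 * b1 ->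
  exists x, ip x (a1 *: v + a2 *: w) = p /\ ip x (b1 *: v + b2 *: w) = q.
Proof.
move=> vv ww vw; rewrite -subr_eq0 => ab; set D := _ - _ in ab.
(* Cramer's rule for the coordinates of x. *)
exists (((p * b2 - q * a2) / D) *: v + ((a1 * q - b1 * p) / D) *: w).
rewrite !ipE (ipC ip w v) vv ww vw.
by split; rewrite /D in ab *; field.
Qed.

(** The point x is chosen so that both cutter inequalities are equalities for
    z = 0; then <0 - x, U (T x) - x> is exactly the value of the form. *)
Lemma sharp_pair (lambda mu : R) v w (a1 a2 b1 b2 : R) :
  0 < lambda -> 0 < mu ->
  ip v v = 1 -> ip w w = 1 -> ip v w = 0 -> a1 * b2 != a2 * b1 ->
  let a := a1 *: v + a2 *: w in let b := b1 *: v + b2 *: w in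
  exists T U, [/\ lrelaxed_cutter ip lambda T, lrelaxed_cutter ip mu U,
    Fix T `&` Fix U !=set0 &
    forall rho, rho * step_form ip lambda mu a b < `|a + b| ^+ 2 ->
      ~ lrelaxed_cutter ip rho (U \o T)].
Proof.
move=> l0 m0 vv ww vw ab a b.
have [x [xa xb]] := ip_interpolation (- (`|a| ^+ 2 / lambda))
  (- (`|b| ^+ 2 / mu) - ip a b) vv ww vw ab.
rewrite -/a -/b in xa xb.
have a0 : a != 0.
  apply: contraNneq ab => aE.
  have : ip a v = 0 by rewrite aE ipC ip0r.
  have : ip a w = 0 by rewrite aE ipC ip0r.
  rewrite /a !ipE (ipC ip w v) vv ww vw !mulr0 !mulr1 add0r addr0 => -> ->.
  by rewrite !mul0r.
have b0 : b != 0.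
  apply: contraNneq ab => bE.
  have : ip b v = 0 by rewrite bE ipC ip0r.
  have : ip b w = 0 by rewrite bE ipC ip0r.
  rewrite /b !ipE (ipC ip w v) vv ww vw !mulr0 !mulr1 add0r addr0 => -> ->.
  by rewrite !mulr0.
have xab : ip (x + a) b = - (`|b| ^+ 2 / mu) by rewrite ipDl xb subrK.
have [cT FT] := lrelaxed_cutter_detour l0 a0 xa.
have [cU FU] := lrelaxed_cutter_detour m0 b0 xab.
exists (detour lambda x a), (detour mu (x + a) b); split=> //.
  by rewrite FT FU; exists 0.
move=> rho lt_rho [rho0 _ /(_ x 0)]; apply/not_implyP; split.
  have T0 : Fix (detour lambda x a) 0 by rewrite FT.
  have U0 : Fix (detour mu (x + a) b) 0 by rewrite FU.
  by rewrite /Fix /= T0.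
apply/negP; rewrite -ltNge /=.
have -> : detour mu (x + a) b (detour lambda x a x) - x = a + b.
  by rewrite /detour !eqxx /= -(addrA x) (addrC x) addrK.
suff -> : ip (0 - x) (a + b) = step_form ip lambda mu a b by [].
by rewrite add0r ipNl ipDr xa xb /step_form; ring.
Qed.

(** Gram-Schmidt for two vectors. *)
Lemma orthonormal_pair : dim_ge H 2 ->
  exists v w, [/\ ip v v = 1, ip w w = 1 & ip v w = 0].
Proof.
move=> [e free_e].
have e0 : e ord0 != 0.
  apply/eqP => e0; have /eqP : ((ord0 : 'I_2) == ord0)%:R = 0 :> R.
    apply: (free_e (fun i => (i == ord0)%:R)).
    by rewrite big_ord_recl big_ord1 /= e0 scaler0 scale0r addr0.
  by rewrite oner_eq0.
pose v := `|e ord0|^-1 *: e ord0.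
pose f := e ord_max - ip v (e ord_max) *: v.
have f0 : f != 0.
  apply/eqP => f0; pose k i : R :=
    if i == ord0 :> 'I_2 then - (ip v (e ord_max) * `|e ord0|^-1) else 1.
  have /eqP : k ord_max = 0.
    apply: (free_e k); rewrite big_ord_recl big_ord1 /k /=.
    rewrite (_ : lift ord0 ord0 = ord_max); last exact: val_inj.
    by rewrite scale1r scaleNr -scalerA addrC.
  by rewrite oner_eq0.
have unit u : u != 0 -> ip (`|u|^-1 *: u) (`|u|^-1 *: u) = 1.
  by move=> u0; rewrite !ipE -ip_norm; field; rewrite normr_eq0.
have vv : ip v v = 1 := unit _ e0.
clearbody v; exists v, (`|f|^-1 *: f); split=> //; first exact: unit.
by rewrite /f !ipE vv; ring.
Qed.
End Counterexamples.

(** * Optimality and failure *)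

Lemma exists_small_sqr (R : realType) (k d : R) : 0 < k -> 0 < d ->
  exists2 eps : R, 0 < eps & k * eps ^+ 2 < d.
Proof.
move=> k0 d0; exists (Num.sqrt (d / (2 * k))).
  by rewrite sqrtr_gt0 divr_gt0 ?mulr_gt0.
rewrite sqr_sqrtr; last by rewrite divr_ge0 ?ltW ?mulr_gt0.
have -> : k * (d / (2 * k)) = d / 2 by field; rewrite gt_eqF.
by rewrite ltr_pdivrMr // mulr_natr mulr2n ltrDl.
Qed.

Section Sharpness.
Context {R : realType} {H : completeNormedModType R}.
Context (ip : {dot H for idfun}) (ip_norm : induces_norm ip).
Context (lambda mu : R) (lambda_gt0 : 0 < lambda) (mu_gt0 : 0 < mu).

(** Collinear steps a = lambda (mu - 2) v and b = mu (lambda - 2) v make the square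
    of [step_form_nu_star] vanish.  Adding eps w to a and subtracting it from b makes
    them independent without changing a + b = - 2 D v, and the value of the form
    becomes |a + b|^2 / nu_star + eps^2 D / (lambda mu). *)
Lemma nu_star_optimal (rho : R) : dim_ge H 2 -> lambda * mu < 4 ->
  0 < rho -> rho < nu_star lambda mu ->
  exists T U : H -> H, [/\ lrelaxed_cutter ip lambda T, lrelaxed_cutter ip mu U,
    Fix T `&` Fix U !=set0 & ~ lrelaxed_cutter ip rho (U \o T)].
Proof.
move=> /(orthonormal_pair ip_norm)[v [w [vv ww vw]]] lm4 rho0 rho_nu.
pose D := lambda + mu - lambda * mu.
have D0 : 0 < D by rewrite subr_gt0 prod_lt_add.
have nu0 := lt_trans rho0 rho_nu.
have [||eps eps0 small] := @exists_small_sqr R (rho * D / (lambda * mu))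
    (4 * D ^+ 2 * (1 - rho / nu_star lambda mu)).
- by rewrite divr_gt0 ?mulr_gt0.
- rewrite mulr_gt0 //; first by rewrite mulr_gt0 // exprn_gt0.
  by rewrite subr_gt0 ltr_pdivrMr // mul1r.
have [|T [U [hT hU TU nrho]]] := sharp_pair ip_norm (a1 := lambda * (mu - 2)) (a2 := eps)
    (b1 := mu * (lambda - 2)) (b2 := - eps) lambda_gt0 mu_gt0 vv ww vw.
  rewrite -subr_eq0.
  have -> : lambda * (mu - 2) * - eps - eps * (mu * (lambda - 2)) = 2 * eps * D.
    by rewrite /D; ring.
  by rewrite !mulf_neq0 ?gt_eqF.
exists T, U; split=> //; apply: nrho.
rewrite /step_form !ip_norm !ipE (ipC ip w v) vv ww vw.
rewrite -subr_gt0; move: small; rewrite -subr_gt0; congr (0 < _).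
rewrite /nu_star /D; field.
by rewrite -/D !gt_eqF // subr_gt0.
Qed.

(** The form takes the value 4 / mu - lambda < 0 on the steps lambda v and - 2 v,
    and adding eps w to the second one adds eps^2 / mu to this value. *)
Lemma comp_not_relaxed_cutter_dim2 : dim_ge H 2 -> 4 < lambda * mu ->
  exists T U : H -> H, [/\ lrelaxed_cutter ip lambda T, lrelaxed_cutter ip mu U,
    Fix T `&` Fix U !=set0 & ~ relaxed_cutter ip (U \o T)].
Proof.
move=> /(orthonormal_pair ip_norm)[v [w [vv ww vw]]] lm4.
have [||eps eps0 small] := @exists_small_sqr R 1 (lambda * mu - 4) => //.
  by rewrite subr_gt0.
have [|T [U [hT hU TU nrho]]] := sharp_pair ip_norm (a1 := lambda) (a2 := 0)
    (b1 := - 2) (b2 := eps) lambda_gt0 mu_gt0 vv ww vw.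
  by rewrite mul0r mulf_neq0 ?gt_eqF.
exists T, U; split=> // -[rho hrho]; apply: (nrho rho) (hrho).
have [rho0 _ _] := hrho.
apply: lt_le_trans (sqr_ge0 _); rewrite pmulr_rlt0 //.
rewrite /step_form !ip_norm !ipE (ipC ip w v) vv ww vw.
rewrite [ltLHS](_ : _ = (1 * eps ^+ 2 - (lambda * mu - 4)) / mu).
  by rewrite pmulr_llt0 ?invr_gt0 // subr_lt0.
by field; rewrite !gt_eqF.
Qed.

(** The composition of the extremal homotheties is multiplication by
    1 - (lambda + mu - lambda mu) > 1, so it moves every nonzero point away from 0. *)
Lemma comp_not_relaxed_cutter_scale : (exists h : H, h != 0) ->
  lambda + mu < lambda * mu ->
  exists T U : H -> H, [/\ lrelaxed_cutter ip lambda T, lrelaxed_cutter ip mu U,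
    Fix T `&` Fix U !=set0 & ~ relaxed_cutter ip (U \o T)].
Proof.
move=> [h h0] lmD.
exists (fun y => (1 - lambda) *: y), (fun y => (1 - mu) *: y).
split; try exact: lrelaxed_cutter_scale.
  by exists 0; rewrite /Fix /= !scaler0.
move=> [rho [rho0 _ /(_ h 0)]]; rewrite /Fix /= !scaler0 => /(_ erefl).
apply/negP; rewrite -ltNge; apply: lt_le_trans (sqr_ge0 _).
rewrite pmulr_rlt0 // add0r.
rewrite [ltLHS](_ : _ = (lambda + mu - lambda * mu) * ip h h).
  by rewrite nmulr_rlt0 ?subr_lt0 // ip_gt0.
by rewrite !ipE; ring.
Qed.

(** The factor 1 - lambda / (lambda - 1) is the inverse of 1 - lambda, and
    lambda / (lambda - 1) <= mu is the hypothesis; so the composition is the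
    identity while each homothety fixes 0 only. *)
Lemma Fix_comp_neq : (exists h : H, h != 0) -> lambda + mu <= lambda * mu ->
  exists T U : H -> H, [/\ lrelaxed_cutter ip lambda T, lrelaxed_cutter ip mu U,
    Fix T `&` Fix U !=set0 & Fix (U \o T) <> Fix T `&` Fix U].
Proof.
move=> [h h0] lmD.
have l1 : 0 < lambda - 1.
  by rewrite -(pmulr_lgt0 _ mu_gt0) mulrBl mul1r subr_gt0 (lt_le_trans _ lmD) // ltrDr.
exists (fun y => (1 - lambda) *: y), (fun y => (1 - lambda / (lambda - 1)) *: y).
split; try apply: lrelaxed_cutter_scale => //.
- by rewrite divr_gt0.
- by rewrite ler_pdivrMr //; nra.
- by exists 0; rewrite /Fix /= !scaler0.
move/(congr1 (@^~ h)); rewrite /setI /= Fix_scale ?gt_eqF //.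
have Ph : Fix ((fun y : H => (1 - lambda / (lambda - 1)) *: y) \o
    (fun y => (1 - lambda) *: y)) h.
  rewrite /Fix /= scalerA -[RHS]scale1r; congr (_ *: _).
  by field; rewrite gt_eqF.
by move=> E; move: Ph; rewrite E => -[/= h00]; move/eqP: h0.
Qed.
End Sharpness.

Theorem theorem3p8 (R : realType) (H : completeNormedModType R)
    (ip : {dot H for idfun}) (ip_norm : induces_norm ip)
    (H_neq0 : exists h : H, h != 0)
    (lambda mu : R) (lambda_gt0 : 0 < lambda) (mu_gt0 : 0 < mu)
    (T U : H -> H)
    (T_cutter : lrelaxed_cutter ip lambda T)
    (U_cutter : lrelaxed_cutter ip mu U)
    (TU_fix : Fix T `&` Fix U !=set0) :
  (* (i) *)
  (forall (x z : H) (nu : R), (Fix T `&` Fix U) z -> nu != 0 ->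
    let a := T x - x in
    let b := (U \o T) x - T x in
    ip (z - x) ((U \o T) x - x) - nu^-1 * `|(U \o T) x - x| ^+ 2 >=
      (lambda^-1 - nu^-1) * `|a| ^+ 2 + (mu^-1 - nu^-1) * `|b| ^+ 2
      + (1 - 2 / nu) * ip a b)
  /\ (* (ii) *)
  (lambda * mu < 4 ->
    lrelaxed_cutter ip (nu_star lambda mu) (U \o T) /\
    (dim_ge H 2 ->
      forall rho : R, 0 < rho -> rho < nu_star lambda mu ->
      exists T' U' : H -> H,
        [/\ lrelaxed_cutter ip lambda T', lrelaxed_cutter ip mu U',
            Fix T' `&` Fix U' !=set0 &
            ~ lrelaxed_cutter ip rho (U' \o T')]))
  /\ (* (iii) *)
  (lambda * mu < lambda + mu -> Fix (U \o T) = Fix T `&` Fix U)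
  /\ (* (iv) *)
  (4 < lambda * mu ->
    (lambda * mu <= lambda + mu /\ dim_ge H 2) \/ lambda + mu < lambda * mu ->
    exists T' U' : H -> H,
      [/\ lrelaxed_cutter ip lambda T', lrelaxed_cutter ip mu U',
          Fix T' `&` Fix U' !=set0 &
          ~ relaxed_cutter ip (U' \o T')])
  /\ (* (v) *)
  (lambda + mu <= lambda * mu ->
    exists T' U' : H -> H,
      [/\ lrelaxed_cutter ip lambda T', lrelaxed_cutter ip mu U',
          Fix T' `&` Fix U' !=set0 &
          Fix (U' \o T') <> Fix T' `&` Fix U'])
  /\ (* (vi) *)
  (demiclosedness_principle ip T -> demiclosedness_principle ip U ->
    lambda * mu != 4 -> lambda * mu < lambda + mu ->
    demiclosedness_principle ip (U \o T) /\
    demiclosedness_principle ip (relaxation (nu_star lambda mu)^-1 (U \o T))).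
Proof.
split; [|split; [|split; [|split; [|split]]]].
- move=> x z nu zTU _; rewrite /= -(step_formE ip_norm) (addrC (T x - x)) subrKA.
  by rewrite lerD2r; exact: step_form_le.
- move=> lm4; split; first exact: lrelaxed_cutter_comp.
  by move=> dim2 rho rho0 rho_nu; exact: nu_star_optimal.
- exact: Fix_comp.
- move=> lm4 [[_ dim2]|lmD]; first exact: comp_not_relaxed_cutter_dim2.
  exact: comp_not_relaxed_cutter_scale.
- exact: Fix_comp_neq.
- move=> dT dU lm4 lmD.
  have dUT := demiclosed_comp ip_norm lambda_gt0 mu_gt0 T_cutter U_cutter TU_fix
    lmD dT dU.
  split=> //; apply: demiclosed_relaxation dUT.
  rewrite /nu_star invr_eq0 mulf_neq0 ?invr_eq0 //.
    by rewrite mulf_neq0 // gt_eqF // subr_gt0.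
  by rewrite subr_eq0 eq_sym.
Qed.
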